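(* Let $(W,S)$ be a Coxeter system with $S=\{s_0,s_1,\ldots,s_n\}$ in which $s_0$ is evenly-laced. Let $W^+$ be its alternating subgroup, generated by $R=\{r_1,\ldots,r_n\}$ with $r_i=s_0s_i$, and write $\ell=\ell_{R\cup R^{-1}}$. Then for every $w\in W^+$: (a) $\ell(w)=|\mathtt{P}_L(w)|$. (b) (Strong exchange property) For any reduced $(R\cup R^{-1})$-word $(r^{(1)},\ldots,r^{(\ell(w))})$ factoring $w$, one has $\mathtt{P}_L(w)=\{p_k: 1\le k\le \ell(w)\}$, where $$p_k:=(r^{(1)})^{-1}(r^{(2)})^{-1}\cdots(r^{(k-1)})^{-1}(r^{(k)})^{-1}(r^{(k-1)})^{-1}\cdots(r^{(2)})^{-1}(r^{(1)})^{-1}.$$ In other words, for a palindrome $p\in\mathtt{P}(W^+)$ the following are equivalent: (i) $\ell(pw)<\ell(w)$; (ii) $p=p_k$ for some $k\in\{1,\ldots,\ell(w)\}$; (iii) $pw=(r^{(1)})^{-1}\cdots(r^{(k-1)})^{-1}r^{(k+1)}\cdots r^{(\ell(w))}$ for some $k\in\{1,\ldots,\ell(w)\}$. (c) The set $\mathtt{P}_L(w)$ determines $w$ uniquely: if $w,w'\in W^+$ and $\mathtt{P}_L(w)=\mathtt{P}_L(w')$ then $w=w'$.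
   Context: A Coxeter system $(W,S)$ with $S=\{s_0,\ldots,s_n\}$: $W$ has presentation with generators $S$ and relations $s_i^2=e$ and $(s_is_j)^{m_{ij}}=e$ for $i\ne j$, where $m_{ij}=m_{ji}\in\{2,3,\ldots\}\cup\{\infty\}$ ($m_{ij}=\infty$ meaning no relation). The node $s_0$ is evenly-laced if $m_{0i}$ is even or $\infty$ for all $i=1,\ldots,n$. The alternating subgroup $W^+$ is the kernel of the sign character $\epsilon:W\to\{\pm1\}$, $\epsilon(s)=-1$ for all $s\in S$; the elements $r_i=s_0s_i$ ($1\le i\le n$) generate $W^+$. For $w\in W^+$, $\ell_{R\cup R^{-1}}(w)$ is the minimal length $\ell$ of an expression $w=a_1\cdots a_\ell$ with $a_i\in R\cup R^{-1}$; such an expression of minimal length is a reduced $(R\cup R^{-1})$-word. An element $g\in W^+$ is an (odd) palindrome if there is a word $(a_1,\ldots,a_\ell)$ in $R\cup R^{-1}$ factoring $g$ with $\ell$ odd and $a_{\ell+1-i}=a_i$ for all $i$; $\mathtt{P}(W^+)$ denotes the set of palindromes. For $w\in W^+$, $\mathtt{P}_L(w):=\{p\in\mathtt{P}(W^+):\ell_{R\cup R^{-1}}(pw)<\ell_{R\cup R^{-1}}(w)\}$. *)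

(* Defs.v *)
From HB Require Import structures.
From mathcomp Require Import all_boot all_order all_algebra.
From mathcomp Require Import mathcomp_extra boolp classical_sets functions.
From mathcomp Require Import cardinality.

Set Implicit Arguments.
Unset Strict Implicit.
Unset Printing Implicit Defensive.

Local Open Scope group_scope.
Local Open Scope classical_set_scope.

Section Presentation.
Variables (I : Type) (W : groupType) (g : I -> W).

(* The letter (i, false) stands for the generator i, and (i, true) for its
   formal inverse. *)
Definition eval (u : seq (I * bool)) : W :=
  \prod_(x <- u) (if x.2 then (g x.1)^-1 else g x.1).

(* Equality in < I | rel >, as the congruence on words over I and I^-1 generated
   by free cancellation and by r = 1 for every relator r. *)
Inductive pres_eq (rel : seq (I * bool) -> Prop) :
    seq (I * bool) -> seq (I * bool) -> Prop :=
| pres_refl u : pres_eq rel u u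
| pres_sym u v : pres_eq rel u v -> pres_eq rel v u
| pres_trans u v w : pres_eq rel u v -> pres_eq rel v w -> pres_eq rel u w
| pres_cancel u v i b :
    pres_eq rel (u ++ [:: (i, b); (i, ~~ b)] ++ v) (u ++ v)
| pres_rel u v r : rel r -> pres_eq rel (u ++ r ++ v) (u ++ v).

Definition has_presentation (rel : seq (I * bool) -> Prop) : Prop :=
  (forall w : W, exists u, eval u = w) /\
  (forall u v, eval u = eval v <-> pres_eq rel u v).

End Presentation.

Section Coxeter.
Variables (n : nat) (W : groupType) (s : 'I_n.+1 -> W).

(* The value None encodes m_ij = oo; the diagonal values of m are not used. *)
Inductive coxeter_rel (m : 'I_n.+1 -> 'I_n.+1 -> option nat) :
    seq ('I_n.+1 * bool) -> Prop :=
| coxeter_rel_sq i : coxeter_rel m [:: (i, false); (i, false)]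
| coxeter_rel_braid i j k : i != j -> m i j = Some k ->
    coxeter_rel m (flatten (nseq k [:: (i, false); (j, false)])).

Definition coxeter_system (m : 'I_n.+1 -> 'I_n.+1 -> option nat) : Prop :=
  [/\ forall i j, m i j = m j i,
      forall i j k, i != j -> m i j = Some k -> (2 <= k)%N
    & has_presentation s (coxeter_rel m)].

Definition evenly_laced (m : 'I_n.+1 -> 'I_n.+1 -> option nat) : Prop :=
  forall i k, i != ord0 -> m ord0 i = Some k -> ~~ odd k.

Definition sign_character (eps : W -> int) : Prop :=
  [/\ forall w, eps w = 1%R \/ eps w = (-1)%R,
      forall x y, eps (x * y) = (eps x * eps y)%R
    & forall i, eps (s i) = (-1)%R].

Definition alternating (eps : W -> int) : {pred W} := [pred w | eps w == 1%R].

(* lift ord0 enumerates the indices 1, ..., n. *)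
Definition altgen (i : 'I_n) : W := s ord0 * s (lift ord0 i).

Definition altletter : pred W :=
  [pred x | (x \in codom altgen) || (x^-1 \in codom altgen)].

Definition altfactor (w : W) (a : seq W) : Prop :=
  all altletter a /\ \prod_(x <- a) x = w.

(* The default value 0 is taken only outside the subgroup generated by the
   altgen i, that is, only outside the alternating subgroup. *)
Definition altlen (w : W) : nat :=
  xget 0%N [set l | (exists2 a, altfactor w a & size a = l) /\
                    (forall a, altfactor w a -> (l <= size a)%N)].

Definition altreduced (w : W) (a : seq W) : Prop :=
  altfactor w a /\ size a = altlen w.

Definition palindromes (eps : W -> int) : set W :=
  [set g | g \in alternating eps /\
           exists a, [/\ altfactor g a, odd (size a) & rev a = a]].

Definition leftpal (eps : W -> int) (w : W) : set W :=
  [set p | palindromes eps p /\ (altlen (p * w) < altlen w)%N].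

End Coxeter.

(* Positions are counted from 0: this is p_(k+1) for the word a. *)
Definition exchange_pal (W : groupType) (a : seq W) (k : nat) : W :=
  (\prod_(x <- take k a) x^-1) * (nth 1 a k)^-1 *
  (\prod_(x <- rev (take k a)) x^-1).

Lemma sign_character_exists n (W : groupType) (s : 'I_n.+1 -> W) m :
  coxeter_system s m -> exists eps, sign_character s eps.
Proof.
case=> _ _ [gen pres].
have par u v : pres_eq (coxeter_rel m) u v -> odd (size u) = odd (size v).
  elim=> // [{}u {}v w _ -> _ //|{}u {}v i b|{}u {}v r rP].
    by rewrite !size_cat !oddD.
  rewrite !size_cat !oddD; suff -> : odd (size r) = false by [].
  case: rP => // i j k _ _.
  by rewrite size_flatten /shape map_nseq sumn_nseq oddM.
have [word wordP] := choice gen.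
have parE u : odd (size (word (eval s u))) = odd (size u).
  by apply/par/pres; rewrite wordP.
exists (fun w => (-1) ^+ odd (size (word w)))%R; split=> [w|x y|i].
- by case: odd; [right|left].
- have -> : x * y = eval s (word x ++ word y).
    by rewrite /eval big_cat /= -!/(eval s _) !wordP.
  by rewrite parE size_cat oddD GRing.signr_addb.
- have -> : s i = eval s [:: (i, false)] by rewrite /eval big_seq1.
  by rewrite parE.
Qed.

(* Main.v *)
(* For t in W and a word in S, count modulo 2 the occurrences of t among the left
   reflections of the word whose letter is not s_0. Since every m_(0i) is even or
   infinite, this parity vanishes on the relators, so it defines a cocycle N(w, t)
   on W. Put H(w, p) := N(w, s_0 p). For w in W^+ and a word a_1 ... a_l in the
   letters r_i and their inverses factoring w, H(w, p) is the parity of the number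
   of k with p = p_k. When the word is reduced the p_k are distinct, so H(w, -) is
   the indicator function of {p_1, ..., p_l}, whence H(w, p) implies
   l(p w) < l(w). For a palindrome p, H(p w, p^-1) is the negation of H(w, p);
   applying the previous implication to p w gives the converse. Finally, if
   H(w, -) = H(w', -) then H(w^-1 w', -) = 0, so w^-1 w' has length 0. *)
Require Import Defs.
From mathcomp Require Import all_boot all_order all_algebra.
From mathcomp Require Import mathcomp_extra boolp classical_sets functions.
From mathcomp Require Import cardinality.

Local Open Scope group_scope.
Local Open Scope classical_set_scope.
Local Open Scope card_scope.

Lemma conjg_eq (G : groupType) (x y z : G) : (x ^ y == z) = (x == z ^ y^-1).
Proof. by rewrite -(inj_eq (@conjg_inj _ y^-1) (x ^ y)) conjgK. Qed.

(** * Left reflections of words in S, and the cocycle that they define on W *)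

Section Cocycle.
Variables (n : nat) (W : groupType) (s : 'I_n.+1 -> W).
Variable (m : 'I_n.+1 -> 'I_n.+1 -> option nat).
Hypotheses (Wcox : coxeter_system s m) (s0even : evenly_laced m).
Set Implicit Arguments.
Unset Strict Implicit.

Lemma gen_sq i : s i * s i = 1.
Proof.
case: Wcox => _ _ [_ pres].
have /pres := pres_rel [::] [::] (coxeter_rel_sq m i).
by rewrite /eval !big_cons !big_nil /= mulg1.
Qed.

Lemma gen_inv i : (s i)^-1 = s i.
Proof. by apply/(mulgI (s i)); rewrite mulgV gen_sq. Qed.

Lemma evenly_lacedW i j k :
  i != j -> m i j = Some k -> odd k -> (i != ord0) && (j != ord0).
Proof.
case: Wcox => mC _ _ ij mij kodd; apply/andP; split; apply/eqP => E.
  have := s0even j k; rewrite -{2}E mij E eq_sym in ij * => /(_ ij erefl).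
  by rewrite kodd.
by have := s0even i k; rewrite -E mC mij => /(_ ij erefl); rewrite kodd.
Qed.

(* The parity of the number of positions p in u whose letter i_p is not 0 and such
   that t = s_(i_1) ... s_(i_p) ... s_(i_1). *)
Fixpoint flips (u : seq ('I_n.+1 * bool)) (t : W) : bool :=
  if u is x :: u' then
    ((x.1 != ord0) && (t == s x.1)) (+) flips u' (t ^ s x.1)
  else false.

Lemma eval_cons x u : eval s (x :: u) = s x.1 * eval s u.
Proof. by rewrite /eval big_cons; case: x.2; rewrite ?gen_inv. Qed.

Lemma eval_cat u v : eval s (u ++ v) = eval s u * eval s v.
Proof. exact: big_cat. Qed.

(** Reading past [u] conjugates every later left reflection by [eval s u]; on words this is already
    the cocycle identity. *)
Lemma flips_cat u v t : flips (u ++ v) t = flips u t (+) flips v (t ^ eval s u).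
Proof.
elim: u t => [|x u IHu] t /=; first by rewrite /eval big_nil conjg1.
by rewrite IHu eval_cons conjgM addbA.
Qed.

(** Dropping the first two letters conjugates by s_i s_j, which shifts the index [p] of the dihedral
    reflections by two. *)
Lemma flips_braid i j k t :
  flips (flatten (nseq k [:: (i, false); (j, false)])) t =
  \big[addb/false]_(0 <= p < k.*2)
    (((if odd p then j else i) != ord0) && (t == (s i * s j) ^+ p * s i)).
Proof.
elim: k t => [|k IHk] t; first by rewrite big_geq.
rewrite doubleS !big_nat_recl // /= IHk expg0 mul1g expg1.
congr (_ (+) (_ (+) _)).
  by rewrite conjg_eq conjgE invgK gen_inv mulgA.
apply: eq_bigr => p _; rewrite negbK; congr (_ && _).
rewrite -conjgM conjg_eq conjgE invgK invgM !gen_inv expgS expgSr.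
by rewrite !mulgA.
Qed.

Lemma flips_rel r t : coxeter_rel m r -> flips r t = false.
Proof.
case=> [i|i j k ij mij] /=.
  by rewrite conjg_eq conjgE invgK mulgV mulg1 addbF addbb.
have xk : (s i * s j) ^+ k = 1.
  have <- :
      eval s (flatten (nseq k [:: (i, false); (j, false)])) = (s i * s j) ^+ k.
    elim: {mij} k => [|k IHk]; first by rewrite /eval big_nil.
    by rewrite /= !eval_cons IHk expgS mulgA.
  case: Wcox => _ _ [_ pres].
  have -> : 1 = eval s [::] by rewrite /eval big_nil.
  apply/pres; rewrite -[flatten _]cats0 -[_ ++ [::]]cat0s.
  exact: (pres_rel [::] [::] (coxeter_rel_braid ij mij)).
(* The terms of index p and p + k coincide: if k is odd then the letters there
   differ, but neither of them is s_0. *)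
rewrite flips_braid -addnn (@big_cat_nat _ _ _ k) ?leq_addr //=.
rewrite -{2}[k]add0n big_addn addnK -big_split big1 // => p _ /=.
rewrite expgnDr xk mulg1 oddD; case: (boolP (odd k)) => kodd.
  have /andP[i0 j0] := evenly_lacedW ij mij kodd.
  by case: (odd p); rewrite /= i0 j0 addbb.
by rewrite addbF addbb.
Qed.

Lemma flips_pres u v t : pres_eq (coxeter_rel m) u v -> flips u t = flips v t.
Proof.
move=> uv; elim: uv t => // {u v}.
- by move=> u v w _ uv _ vw t; rewrite uv.
- move=> u v i b t; rewrite !flips_cat; congr (_ (+) _).
  have -> x : x ^ eval s [:: (i, b); (i, ~~ b)] = x.
    by rewrite !eval_cons /eval big_nil mulg1 gen_sq conjg1.
  (* [flips] ignores the sign of a letter, so a cancelling pair counts like the relator s_i s_i. *)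
  by have /= -> := flips_rel (t ^ eval s u) (coxeter_rel_sq m i).
- move=> u v r rP t; rewrite !flips_cat (flips_rel _ rP) //=.
  case: Wcox => _ _ [_ pres].
  have -> : eval s r = 1.
    transitivity (eval s [::]); last by rewrite /eval big_nil.
    apply/pres; by have := pres_rel [::] [::] rP; rewrite /= cats0.
  by rewrite conjg1.
Qed.

(** Any choice of words representing the elements of W will do, since [flips] is constant on the
    classes of [pres_eq]. *)
Lemma reflection_cocycle : exists N : W -> W -> bool,
  (forall x y t, N (x * y) t = N x t (+) N y (t ^ x)) /\
  (forall i t, N (s i) t = (i != ord0) && (t == s i)).
Proof.
case: Wcox => _ _ [gen pres]; have [word wordP] := choice gen.
have wordE u t : flips (word (eval s u)) t = flips u t.
  by apply/flips_pres/pres.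
exists (fun x => flips (word x)); split=> [x y t|i t].
  by rewrite -{1}(wordP x) -{1}(wordP y) -eval_cat wordE flips_cat wordP.
have -> : s i = eval s [:: (i, false)] by rewrite /eval big_seq1.
by rewrite wordE /= addbF eval_cons /eval big_nil mulg1.
Qed.

End Cocycle.

(** * Words in the letters r_i and their inverses, length, and exchange palindromes *)

Section Alternating.
Set Implicit Arguments.
Unset Strict Implicit.
Variables (n : nat) (W : groupType) (s : 'I_n.+1 -> W).

Local Notation letters := (all (altletter s)).

Lemma altletterV x : altletter s x^-1 = altletter s x.
Proof. by rewrite /altletter /= invgK orbC. Qed.

Lemma lettersV a : letters [seq x^-1 | x <- a] = letters a.
Proof. by rewrite all_map; apply: eq_all => x; exact: altletterV. Qed.

Lemma altfactorM x y a b :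
  altfactor s x a -> altfactor s y b -> altfactor s (x * y) (a ++ b).
Proof.
by move=> [aL <-] [bL <-]; split; rewrite ?all_cat ?aL // big_cat.
Qed.

Lemma altfactorV x a :
  altfactor s x a -> altfactor s x^-1 (rev [seq y^-1 | y <- a]).
Proof.
move=> [aL <-]; split; first by rewrite all_rev lettersV.
by rewrite -map_rev big_map prodgV revK.
Qed.

(** A single factorization makes the minimum exist, so [altlen] does not fall back on its default
    value. *)
Lemma altlenP x a :
  altfactor s x a -> (exists b, altreduced s x b) /\ (altlen s x <= size a)%N.
Proof.
move=> xa; pose P l := `[< exists2 b, altfactor s x b & size b = l >].
have exP : exists l, P l by exists (size a); apply/asboolP; exists a.
have [[c xc sc] lmin] : [set l | (exists2 c, altfactor s x c & size c = l) /\
    (forall c, altfactor s x c -> (l <= size c)%N)] (altlen s x).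
  apply: xgetPex; exists (ex_minn exP); case: ex_minnP => l /asboolP lP lmin.
  by split=> // b xb; apply: lmin; apply/asboolP; exists b.
by split; [exists c | exact: lmin].
Qed.

Lemma exchange_pal0 (x : W) a : exchange_pal (x :: a) 0 = x^-1.
Proof. by rewrite /exchange_pal /= !big_nil mul1g mulg1. Qed.

Lemma exchange_palS (x : W) a k :
  exchange_pal (x :: a) k.+1 = x^-1 * exchange_pal a k * x^-1.
Proof.
by rewrite /exchange_pal /= rev_cons big_cons big_rcons /= !mulgA.
Qed.

(** The middle letter and right half of the palindrome cancel the first [k.+1] letters of the word;
    its left half remains. *)
Lemma exchange_palM (a : seq W) k :
  exchange_pal a k * \prod_(x <- a) x =
  (\prod_(x <- take k a) x^-1) * (\prod_(x <- drop k.+1 a) x).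
Proof.
elim: a k => [|x a IHa] [|k].
(* On the empty word the default letter 1 of [nth] makes the palindrome trivial, so the identity
   holds for every [k]. *)
- by rewrite /exchange_pal /= !big_nil invg1 !mulg1.
- by rewrite /exchange_pal /= !big_nil invg1 !mulg1.
- by rewrite exchange_pal0 /= big_nil big_cons mul1g mulKg drop0.
- by rewrite exchange_palS /= !big_cons mulgA mulgVK -!(mulgA x^-1) IHa.
Qed.

Lemma altfactor_exchange a k : letters a -> (k < size a)%N ->
  exists2 b, altfactor s (exchange_pal a k * \prod_(x <- a) x) b &
             size b = (size a).-1.
Proof.
move=> aL klt.
have tdL l : letters (take l a) && letters (drop l a).
  by rewrite -all_cat cat_take_drop.
exists ([seq x^-1 | x <- take k a] ++ drop k.+1 a).
  rewrite exchange_palM; apply: altfactorM; split; rewrite ?big_map //.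
    by rewrite lettersV; have /andP[] := tdL k.
  by have /andP[] := tdL k.+1.
rewrite size_cat size_map size_take size_drop klt.
case: (size a) klt => // l klt; by rewrite subSS subnKC.
Qed.

(* If p_i = p_j, the letters i and j can be removed from the word, at the cost of
   inverting those strictly between them. *)
Lemma altfactor_exchange_eq a i j : letters a -> (i < j < size a)%N ->
  exchange_pal a i = exchange_pal a j ->
  exists2 b, altfactor s (\prod_(x <- a) x) b & (size b < size a)%N.
Proof.
elim: a i j => [|x a IHa] i [|j] //=; rewrite ?andbF // => /andP[xL aL].
case: i => [|i] /andP[ltij ja]; rewrite ?exchange_pal0 !exchange_palS.
  (* For [i = 0] the equation says that the palindrome of the tail [a] at [j] is [x] itself, so the
     whole product is an exchange applied to [a]. *)
  rewrite -mulgA -{1}(mulg1 x^-1) => /mulgI/esym/divg1_eq qx.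
  rewrite big_cons -{1}qx.
  have [b bf bs] := altfactor_exchange aL ja; exists b => //.
  by rewrite bs; case: (size a) ja.
move=> /mulIg/mulgI eqij.
have [|b [bL bE] bs] := IHa _ _ aL _ eqij; first exact/andP.
by exists (x :: b) => //; split; rewrite /= ?xL // !big_cons bE.
Qed.

(** A coincidence would yield a factorization shorter than a reduced one. *)
Lemma exchange_pal_inj w a : altreduced s w a ->
  {in gtn (size a) &, injective (exchange_pal a)}.
Proof.
move=> [[aL aw] sa] i j; wlog ltij : i j / (i < j)%N => [IH|] ia ja eqij.
  by case: (ltngtP i j) => // ij; [|apply/esym]; apply: IH.
have [|b bf] := altfactor_exchange_eq aL _ eqij; first exact/andP.
by rewrite aw in bf; rewrite ltnNge sa (altlenP bf).2.
Qed.

Lemma palindrome_exchange a k : letters a -> (k < size a)%N ->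
  exists b, [/\ altfactor s (exchange_pal a k) b, odd (size b) & rev b = b].
Proof.
elim: a k => // x a IHa [|k] /= /andP[xL aL] ka.
  exists [:: x^-1]; rewrite exchange_pal0; split=> //.
  split; rewrite ?big_seq1 //; by rewrite /= andbT altletterV.
have [b [[bL bE] bo br]] := IHa k aL ka.
exists (x^-1 :: rcons b x^-1); split; last by rewrite rev_cons rev_rcons br.
  rewrite exchange_palS; split.
    by rewrite /= all_rcons bL andbT altletterV xL.
  by rewrite big_cons big_rcons bE /= mulgA.
by rewrite /= size_rcons /= negbK.
Qed.

Lemma altlen_exchange w a k : altreduced s w a -> (k < altlen s w)%N ->
  (altlen s (exchange_pal a k * w) < altlen s w)%N.
Proof.
move=> [[aL <-] sa]; rewrite -sa => ka.
have [b bf bs] := altfactor_exchange aL ka.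
by apply: leq_ltn_trans (altlenP bf).2 _; rewrite bs ltn_predL (leq_trans _ ka).
Qed.

(** * The sign character and factorizations in W^+ *)

Variables (eps : W -> int) (epsP : sign_character s eps).

Lemma eps1 : eps 1 = 1%R.
Proof.
by case: epsP => + M _ => /(_ 1)[] // E; have := M 1 1; rewrite mulg1 E.
Qed.

Lemma epsV x : eps x^-1 = eps x.
Proof.
case: epsP => V M _; have := M x^-1 x; rewrite mulVg eps1.
by case: (V x) => ->; case: (V x^-1) => ->.
Qed.

Lemma eps_letter x : altletter s x -> eps x = 1%R.
Proof.
case: epsP => V M S; have gen i : eps (altgen s i) = 1%R by rewrite M !S.
by case/orP => /codomP[i E]; last rewrite -epsV; rewrite E gen.
Qed.

Lemma altfactor_alternating w a : altfactor s w a -> w \in alternating eps.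
Proof.
case: epsP => _ M _ [aL <-]; rewrite inE.
elim: a aL => [|x a IHa] /=; first by rewrite big_nil eps1.
by move=> /andP[xL /IHa/eqP aE]; rewrite big_cons M eps_letter // aE.
Qed.

Lemma palindromesE p : palindromes s eps p <->
  exists a, [/\ altfactor s p a, odd (size a) & rev a = a].
Proof.
split=> [[]//|pal]; split=> //.
by case: pal => a [/altfactor_alternating].
Qed.

Variables (m : 'I_n.+1 -> 'I_n.+1 -> option nat).
Hypotheses (Wcox : coxeter_system s m) (s0even : evenly_laced m).

Lemma altletterP x : altletter s x ->
  exists2 i, i != ord0 & x = s ord0 * s i \/ x = s i * s ord0.
Proof.
case/orP => /codomP[i E]; exists (lift ord0 i); rewrite ?lift_eqF //.
  by left.
by right; rewrite -[x]invgK E invgM !(gen_inv Wcox).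
Qed.

(** Pushing s_0 to the right writes any element of W as a word in the letters times s_0^e; the sign
    then forces e = 0 on W^+. *)
Lemma alternating_altfactor w :
  w \in alternating eps -> exists a, altfactor s w a.
Proof.
have s0V := gen_inv Wcox ord0; have s0s0 := gen_sq Wcox ord0.
have fac : exists a e, letters a /\ w = \prod_(x <- a) x * s ord0 ^+ (e : bool).
  case: Wcox => _ _ [gen _]; have [u <-] := gen w.
  elim/last_ind: u => [|u [i b] [a [e [aL uE]]]].
    by exists [::], false; rewrite /eval !big_nil mulg1.
  have -> : eval s (rcons u (i, b)) = \prod_(x <- a) x * s ord0 ^+ e * s i.
    rewrite -cats1 eval_cat uE; congr (_ * _).
    by rewrite (eval_cons Wcox) /eval big_nil mulg1.
  case: (unliftP ord0 i) => [j|] ->.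
    set r := s (lift ord0 j).
    have rL : altletter s (s ord0 * r) by rewrite /altletter /= codom_f.
    have rVL : altletter s (r * s ord0).
      by rewrite -altletterV invgM s0V (gen_inv Wcox).
    exists (rcons a (if e then s ord0 * r else r * s ord0)), (~~ e).
    split; first by rewrite all_rcons aL andbT; case: e {uE}.
    rewrite big_rcons /=; case: e {uE}; rewrite /= ?mulg1 ?mulgA //.
    by rewrite -!mulgA s0s0 mulg1.
  exists a, (~~ e); split=> //; case: e uE => uE /=.
    by rewrite -mulgA s0s0.
  by rewrite mulg1.
case: fac => a [e [aL wE]]; case: e wE => [|]; last first.
  by rewrite mulg1 => wE _; exists a.
case: epsP => _ M S wE; rewrite inE wE M S.
by have /eqP -> := altfactor_alternating (conj aL erefl).
Qed.

(** * The cocycle on W^+, its values on words, and its behaviour under palindromes *)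

Lemma alternating_cocycle : exists H : W -> W -> bool,
  (forall p, H 1 p = false) /\
  (forall a x p, altletter s a ->
     H (a * x) p = (p == a^-1) (+) H x (a * p * a)).
Proof.
have [N [NM Ns]] := reflection_cocycle Wcox s0even.
have sV := gen_inv Wcox; have ss := gen_sq Wcox.
(* Conjugation by s_0 inverts the letters, so s_0 p is a reflection conjugate to
   some s_i, i <> 0, when p is a palindrome. *)
exists (fun x p => N x (s ord0 * p)); split=> [p|a x p aL].
  by have := NM 1 1 (s ord0 * p); rewrite mulg1 conjg1; case: (N _ _).
have [i i0 aE] := altletterP aL.
rewrite NM; congr (_ (+) N _ _); last first.
  (* Since a^-1 = s_0 a s_0, conjugating s_0 p by a gives s_0 (a p a). *)
  rewrite conjgE.
  have -> : a^-1 = s ord0 * a * s ord0.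
    case: aE => ->; rewrite invgM !sV; first by rewrite mulgA ss mul1g.
    by rewrite -!mulgA ss mulg1.
  by rewrite -!mulgA (mulgA (s ord0) (s ord0)) ss mul1g.
(* Only the letter s_i of a counts; its left reflection, s_0 s_i s_0 or s_i, is s_0 a^-1 in both
   cases. *)
case: aE => ->; rewrite NM !Ns i0 eqxx /= ?addbF invgM !sV.
  by rewrite conjg_eq conjgE invgK sV (inj_eq (mulgI _)).
by rewrite -(inj_eq (mulgI (s ord0)) (s ord0 * p)) mulgA ss mul1g.
Qed.

Variables (H : W -> W -> bool) (H1 : forall p, H 1 p = false).
Hypothesis HM : forall a x p, altletter s a ->
  H (a * x) p = (p == a^-1) (+) H x (a * p * a).

(** Both sides obey the same recursion: past a first letter [x], testing [p] becomes testing
    [x * p * x] on the tail. *)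
Lemma cocycle_word a p : letters a ->
  H (\prod_(x <- a) x) p = odd (count_mem p (mkseq (exchange_pal a) (size a))).
Proof.
elim: a p => [|x a IHa] p /=; first by rewrite big_nil H1.
move=> /andP[xL aL]; rewrite big_cons HM // IHa // /mkseq /= exchange_pal0.
rewrite oddD oddb eq_sym; congr (_ (+) odd _).
rewrite (iotaDl 1 0) -map_comp !count_map; apply: eq_count => k /=.
rewrite exchange_palS; set q := exchange_pal a k.
rewrite -(inj_eq (mulgI x) (_ * q * _)) -(inj_eq (mulIg x) (x * _)).
by rewrite !mulgA mulgV mul1g mulgVK.
Qed.

Lemma cocycle_reducedP {w a p} : altreduced s w a ->
  reflect (exists2 k, (k < altlen s w)%N & p = exchange_pal a k) (H w p).
Proof.
move=> wa; have [[aL aE] <-] := wa; rewrite -aE cocycle_word //.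
rewrite count_uniq_mem ?oddb; last exact/mkseq_uniqP/(exchange_pal_inj wa).
apply: (iffP mapP) => -[k]; first by rewrite mem_iota => klt ->; exists k.
by move=> klt ->; exists k; rewrite // mem_iota.
Qed.

(** For p = x q x, peeling the outer letters passes from (p, w) to (q, x w); the two corrections
    both test q = x^-1 and cancel. At a one-letter palindrome the correction is always true, whence
    the negation. *)
Lemma cocycle_palindrome w p : palindromes s eps p -> H (p * w) p^-1 = ~~ H w p.
Proof.
move=> /palindromesE[a [[aL <-] ao ar]].
have [k] := ubnP (size a).
elim: k a w aL ao ar => // k IHk [|x a] w //= /andP[xL aL].
case/lastP: a aL => [|a y] aL ao ar ak.
  by rewrite !big_seq1 HM // eqxx mulgV mul1g.
move: ar; rewrite rev_cons rev_rcons => -[yx] /rcons_inj[ar].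
rewrite {}yx in aL *.
have {aL} aL : letters a by move: aL; rewrite all_rcons => /andP[].
have ao' : odd (size a) by move: ao; rewrite /= size_rcons /= negbK.
have ak' : (size a < k)%N by move: ak; rewrite size_rcons !ltnS; exact: ltnW.
rewrite big_cons big_rcons /=; set q := \prod_(z <- a) z.
rewrite -!mulgA HM // !invgM !mulgA mulgV mul1g mulgVK.
have := IHk a (x * w) aL ao' ar ak'; rewrite -/q (@HM x w) // mulgA => -> _.
have -> : (x^-1 * q^-1 * x^-1 == x^-1) = (q == x^-1).
  by rewrite -mulgA -{3}(mulg1 x^-1) (inj_eq (mulgI _)) mulg_eq1 eqg_invLR
             invgK.
by rewrite addbN addbA addbb.
Qed.

Lemma altlen_palindrome w p : w \in alternating eps -> palindromes s eps p ->
  (altlen s (p * w) < altlen s w)%N = H w p.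
Proof.
have lt x q : x \in alternating eps -> H x q ->
    (altlen s (q * x) < altlen s x)%N.
  move=> /alternating_altfactor[b /altlenP[[a xa] _]].
  move=> /(cocycle_reducedP xa)[k ka ->]; exact: altlen_exchange xa ka.
move=> wA pP; case Hwp: (H w p); first exact: lt.
apply/negbTE; rewrite -leqNgt ltnW //.
have pwA : p * w \in alternating eps.
  have /palindromesE[a [pa _ _]] := pP.
  have [b wb] := alternating_altfactor wA.
  exact: altfactor_alternating (altfactorM pa wb).
by have := lt _ p^-1 pwA; rewrite mulKg cocycle_palindrome // Hwp; apply.
Qed.

Lemma cocycle_inj w w' : w \in alternating eps -> w' \in alternating eps ->
  H w =1 H w' -> w = w'.
Proof.
move=> wA w'A ww'.
have [a wa] := alternating_altfactor wA.
have [b w'b] := alternating_altfactor w'A.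
have [cL cE] := altfactorV wa; set c := rev _ in cL cE.
(* Prepending the letters of w^-1 to w and to w' adds the same terms to both values, and w^-1 w = 1
   has value 0. *)
have Hc p : H (w^-1 * w') p = false.
  rewrite -(H1 p) -(mulVg w) -{}cE; elim: c p cL => [|x c IHc] p /=.
    by rewrite big_nil !mul1g.
  by move=> /andP[xL cL]; rewrite big_cons -!mulgA !(@HM x) // IHc.
have [[[|x d] wd] _] := altlenP (altfactorM (conj cL cE) w'b).
  by case: wd => -[_]; rewrite big_nil => /esym/mulg1_eq; rewrite invgK.
(* A nonempty reduced word would make the cocycle true at its own first palindrome. *)
have /(cocycle_reducedP wd) : exists2 k, (k < altlen s (w^-1 * w'))%N &
    exchange_pal (x :: d) 0 = exchange_pal (x :: d) k.
  by exists 0; rewrite -?wd.2.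
by rewrite Hc.
Qed.

End Alternating.

Theorem theorem3p15 (n : nat) (W : groupType) (s : 'I_n.+1 -> W)
    (m : 'I_n.+1 -> 'I_n.+1 -> option nat) (eps : W -> int)
    (Wcox : coxeter_system s m) (s0even : evenly_laced m)
    (epsP : sign_character s eps) :
  [/\ forall w, w \in alternating eps ->
        leftpal s eps w #= `I_(altlen s w),
      forall w a, w \in alternating eps -> altreduced s w a ->
        leftpal s eps w = [set exchange_pal a k | k in `I_(altlen s w)] /\
        forall p, palindromes s eps p ->
          [<-> (altlen s (p * w) < altlen s w)%N;
               exists2 k, (k < altlen s w)%N & p = exchange_pal a k;
               exists2 k, (k < altlen s w)%N &
                 p * w = (\prod_(x <- take k a) x^-1) *
                         (\prod_(x <- drop k.+1 a) x)]
    & forall w w', w \in alternating eps -> w' \in alternating eps ->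
        leftpal s eps w = leftpal s eps w' -> w = w'].
Proof.
have [H [H1 HM]] := alternating_cocycle Wcox s0even.
have red := cocycle_reducedP H1 HM.
have ltH w p (wA : w \in alternating eps) (pP : palindromes s eps p) :=
  altlen_palindrome epsP Wcox H1 HM wA pP.
have fac w := @alternating_altfactor _ _ _ _ epsP _ Wcox w.
have leftE w : w \in alternating eps -> leftpal s eps w = [set p | H w p].
  move=> wA; have [b /altlenP[[a wa] _]] := fac w wA.
  apply/seteqP; split=> p /=; first by case=> pP; rewrite (ltH w p wA pP).
  (* The cocycle detects only palindromes: where it is true, p is one of the p_k of a reduced
     word. *)
  move=> Hp; have pP : palindromes s eps p.
    have [k kw ->] := red _ _ _ wa Hp; apply/(palindromesE epsP).
    by apply: palindrome_exchange; [case: wa => -[] | rewrite wa.2].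
  by split; rewrite // (ltH w p wA pP).
have setE w a : w \in alternating eps -> altreduced s w a ->
    leftpal s eps w = [set exchange_pal a k | k in `I_(altlen s w)].
  move=> wA wa; rewrite leftE //; apply/seteqP; split=> p /=.
    by move=> /(red _ _ _ wa)[k kw ->]; exists k.
  by move=> [k kw <-]; apply/(red _ _ _ wa); exists k.
split=> [w wA|w a wA wa|w w' wA w'A].
- have [b /altlenP[[a wa] _]] := fac w wA; rewrite (setE w a) //.
  apply: inj_card_eq => i j; rewrite !inE /= -wa.2.
  exact: (exchange_pal_inj wa).
- split; first exact: setE.
  have wE : w = \prod_(x <- a) x by case: wa => -[].
  move=> p pP; tfae.
  + by rewrite (ltH w p wA pP) => /(red _ _ _ wa).
  + by move=> [k kw ->]; exists k; rewrite // wE exchange_palM.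
  + move=> [k kw E]; rewrite (ltH w p wA pP); apply/(red _ _ _ wa).
    exists k => //.
    by apply: (mulIg w); rewrite E wE exchange_palM.
- rewrite !leftE // => E; apply: (cocycle_inj epsP Wcox H1 HM) => // p.
  by apply/idP/idP; have := congr1 (@^~ p) E => /= ->.
Qed.
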